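(* For all integers $n\ge 53$, $$n!\ge \sqrt{2\pi n}\left(\frac{n}{e}\right)^n \exp\left(\frac{1}{12n}-\frac{1}{360n^3}+\frac{1}{1260n^5}-\frac{1}{1680n^7+2375n^5}\right).$$
   Context: Here $e$ is the base of the natural logarithm, $\exp(x)=e^x$, and $n!$ is the usual factorial. *)

(* Defs.v *)
(* Stdlib's classical real numbers R. *)
From Stdlib Require Export Reals Factorial.

(* Main.v *)
Require Import Defs.
From Stdlib Require Import Reals Factorial Lra Lia.
From Coquelicot Require Import Coquelicot.
Open Scope R_scope.

(** Put [stirling_log n] = ln n! - (n + 1/2) ln n + n.  The theorem says that this
    exceeds ln (2 pi) / 2 by at least the rational function in the exponent,
    which agrees with the asymptotic Stirling series up to the order n^-7; the
    constant 2375 is chosen so that 2375/1680^2 falls just short of the next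
    coefficient 1/1188.

    The difference between [stirling_log n] and the rational function is not
    monotone near n = 53, so a telescoping argument cannot be applied to that
    function directly.  It is applied to [stirling_series], the Stirling series
    truncated after the n^-11 term, for which it works from n = 1 on.  With
    y = 1/(2n+1), the decrement stirling_log n - stirling_log (n+1) equals
    artanh y / y - 1 = y^2/3 + y^4/5 + ..., and the terms up to y^12 already
    dominate the decrement of [stirling_series] ([stirling_log_step_ge]).  Hence
    stirling_log - stirling_series is nonincreasing, and it lies above its limit
    ln (2 pi) / 2 ([stirling_series_le_stirling_log]).  That the limit is at least
    this comes from Wallis' inequality ([stirling_log_wallis]).  Finally
    [stirling_series] dominates the rational function as soon as n >= 53
    ([rational_bound_le_stirling_series]). *)

(** * Wallis' inequality *)

(** The integrand is the derivative of - cos x sin^(n+1) x, which vanishes at both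
    ends of the interval. *)
Lemma is_RInt_sin_pow_recurrence (n : nat) :
  is_RInt (fun x => INR (n + 2) * sin x ^ (n + 2) - INR (n + 1) * sin x ^ n)
    0 (PI / 2) 0.
Proof.
evar_last.
- apply (is_RInt_derive (fun x => - cos x * sin x ^ (n + 1))).
  + intros x _. auto_derive; [trivial|].
    replace (Nat.pred (n + 1)) with n by lia.
    assert (Hc : cos x * cos x = 1 - sin x * sin x)
      by (generalize (sin2_cos2 x); unfold Rsqr; lra).
    rewrite !plus_INR, !pow_add; simpl.
    transitivity (sin x * (sin x ^ n * sin x)
                  - (INR n + 1) * (cos x * cos x) * sin x ^ n); [ring|].
    rewrite Hc; ring.
  + intros x _. apply (ex_derive_continuous (V := R_NormedModule)). auto_derive; trivial.
- rewrite cos_PI2, sin_0, pow_ne_zero by lia.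
  unfold minus, plus, opp; simpl; ring.
Qed.

Definition sin_pow_integral (n : nat) : R := RInt (fun x => sin x ^ n) 0 (PI / 2).

Lemma ex_RInt_sin_pow (n : nat) : ex_RInt (fun x => sin x ^ n) 0 (PI / 2).
Proof.
apply (ex_RInt_continuous (V := R_CompleteNormedModule)); intros x _.
apply (ex_derive_continuous (V := R_NormedModule)). auto_derive; trivial.
Qed.

Lemma sin_pow_integral_SS (n : nat) :
  INR (n + 2) * sin_pow_integral (n + 2) = INR (n + 1) * sin_pow_integral n.
Proof.
assert (H := is_RInt_unique _ _ _ _ (is_RInt_sin_pow_recurrence n)).
assert (H' := is_RInt_unique _ _ _ _
  (is_RInt_minus _ _ _ _ _ _
    (is_RInt_scal _ _ _ (INR (n + 2)) _ (RInt_correct _ _ _ (ex_RInt_sin_pow (n + 2))))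
    (is_RInt_scal _ _ _ (INR (n + 1)) _ (RInt_correct _ _ _ (ex_RInt_sin_pow n))))).
unfold minus, plus, opp, scal in H'; simpl in H'; unfold mult in H'; simpl in H'.
unfold sin_pow_integral.
enough (INR (n + 2) * RInt (fun x => sin x ^ (n + 2)) 0 (PI / 2)
  + - (INR (n + 1) * RInt (fun x => sin x ^ n) 0 (PI / 2)) = 0) by lra.
etransitivity; [symmetry; exact H'|exact H].
Qed.

Lemma sin_pow_integral_antitone (n : nat) :
  sin_pow_integral (S n) <= sin_pow_integral n.
Proof.
apply RInt_le; try apply ex_RInt_sin_pow.
- generalize PI_RGT_0; lra.
- intros x Hx; simpl.
  assert (0 <= sin x) by (apply sin_ge_0; generalize PI_RGT_0; lra).
  generalize (SIN_bound x) (pow_le _ n H); nra.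
Qed.

Lemma sin_pow_integral_even (n : nat) :
  sin_pow_integral (2 * n) * (2 ^ n * INR (fact n)) ^ 2
  = PI / 2 * INR (fact (2 * n)).
Proof.
induction n as [|n IH].
- unfold sin_pow_integral; simpl.
  rewrite RInt_const; unfold scal; simpl; unfold mult; simpl; field.
- generalize (sin_pow_integral_SS (2 * n)).
  replace (2 * S n)%nat with (2 * n + 2)%nat by lia.
  replace (fact (2 * n + 2)) with ((2 * n + 2) * ((2 * n + 1) * fact (2 * n)))%nat
    by (replace (2 * n + 2)%nat with (S (S (2 * n))) by lia;
        rewrite !fact_simpl; lia).
  rewrite fact_simpl, !mult_INR, !plus_INR, mult_INR, (S_INR n).
  set (J := sin_pow_integral (2 * n)) in *.
  set (J' := sin_pow_integral (2 * n + 2)).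
  rewrite <- (tech_pow_Rmult 2 n); simpl (INR 2); simpl (INR 1).
  intros Hr.
  transitivity ((2 * INR n + 2) * ((2 * INR n + 2) * J')
                * (2 ^ n * INR (fact n)) ^ 2); [ring|].
  replace ((2 * INR n + 2) * J') with ((2 * INR n + 1) * J) by lra.
  transitivity ((2 * INR n + 2) * (2 * INR n + 1)
                * (J * (2 ^ n * INR (fact n)) ^ 2)); [ring|].
  rewrite IH; ring.
Qed.

Lemma sin_pow_integral_odd (n : nat) :
  sin_pow_integral (2 * n + 1) * INR (fact (2 * n + 1))
  = (2 ^ n * INR (fact n)) ^ 2.
Proof.
induction n as [|n IH].
- simpl. rewrite Rmult_1_r.
  transitivity 1; [|ring].
  apply is_RInt_unique.
  evar_last.
  + apply (is_RInt_derive (fun x => - cos x)).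
    * intros x _. auto_derive; [trivial|ring].
    * intros x _. apply (ex_derive_continuous (V := R_NormedModule)).
      auto_derive; trivial.
  + rewrite cos_PI2, cos_0; unfold minus, plus, opp; simpl; ring.
- generalize (sin_pow_integral_SS (2 * n + 1)).
  replace (2 * S n + 1)%nat with (2 * n + 1 + 2)%nat by lia.
  replace (fact (2 * n + 1 + 2))
    with ((2 * n + 1 + 2) * ((2 * n + 1 + 1) * fact (2 * n + 1)))%nat
    by (replace (2 * n + 1 + 2)%nat with (S (S (2 * n + 1))) by lia;
        rewrite !fact_simpl; lia).
  rewrite fact_simpl, !mult_INR, !plus_INR, mult_INR, (S_INR n).
  set (J := sin_pow_integral (2 * n + 1)) in *.
  set (J' := sin_pow_integral (2 * n + 1 + 2)).
  rewrite <- (tech_pow_Rmult 2 n); simpl (INR 2); simpl (INR 1).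
  intros Hr.
  transitivity ((2 * INR n + 1 + 2) * J' * ((2 * INR n + 1 + 1)
                * INR (fact (2 * n + 1)))); [ring|].
  replace ((2 * INR n + 1 + 2) * J') with ((2 * INR n + 1 + 1) * J) by lra.
  transitivity ((2 * INR n + 2) ^ 2
                * (J * INR (fact (2 * n + 1)))); [ring|].
  rewrite IH; ring.
Qed.

(** The even and odd integrals are explicit, and the comparison of the one of
    index 2n with the one of index 2n - 1 is the stated inequality. *)
Lemma wallis_lower_bound (n : nat) : (1 <= n)%nat ->
  PI * INR n * INR (fact (2 * n)) ^ 2 <= (2 ^ n * INR (fact n)) ^ 4.
Proof.
intros Hn; destruct n as [|m]; [lia|]; clear Hn.
assert (He := sin_pow_integral_even (S m)).
assert (Ho := sin_pow_integral_odd m).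
assert (Hle := sin_pow_integral_antitone (2 * m + 1)).
replace (S (2 * m + 1)) with (2 * S m)%nat in Hle by lia.
assert (HA : 2 ^ S m * INR (fact (S m)) = 2 * INR (S m) * (2 ^ m * INR (fact m)))
  by (rewrite fact_simpl, mult_INR, <- (tech_pow_Rmult 2 m); ring).
assert (HF : INR (fact (2 * S m)) = 2 * INR (S m) * INR (fact (2 * m + 1)))
  by (replace (2 * S m)%nat with (S (2 * m + 1)) by lia;
      rewrite fact_simpl, mult_INR; f_equal;
      rewrite !S_INR, plus_INR, mult_INR; simpl; ring).
assert (HN : 0 < INR (S m)) by (apply lt_0_INR; lia).
assert (HB : 0 < 2 ^ m * INR (fact m))
  by (apply Rmult_lt_0_compat; [apply pow_lt; lra|apply INR_fact_lt_0]).
assert (HG := INR_fact_lt_0 (2 * m + 1)).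
rewrite HA, HF in *.
set (B := 2 ^ m * INR (fact m)) in *.
set (G := INR (fact (2 * m + 1))) in *.
set (N := INR (S m)) in *.
set (X := sin_pow_integral (2 * S m)) in *.
set (Y := sin_pow_integral (2 * m + 1)) in *.
clearbody B G N X Y; clear HA HF.
transitivity (4 * N ^ 2 * G * (2 * N * B) ^ 2 * X).
- right.
  transitivity (4 * N ^ 2 * G * (PI / 2 * (2 * N * G))); [field|].
  rewrite <- He; ring.
- transitivity (4 * N ^ 2 * (2 * N * B) ^ 2 * (Y * G)).
  + transitivity (4 * N ^ 2 * G * (2 * N * B) ^ 2 * Y); [|right; ring].
    apply Rmult_le_compat_l; [|exact Hle].
    assert (0 < N ^ 2) by (apply pow_lt; lra).
    assert (0 < (2 * N * B) ^ 2)
      by (apply pow_lt; repeat apply Rmult_lt_0_compat; lra).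
    apply Rlt_le; repeat apply Rmult_lt_0_compat; lra.
  + rewrite Ho; right; ring.
Qed.

(** * Bounds for ln ((1 + y) / (1 - y)) *)

Lemma le_of_derive_le (f g df dg : R -> R) (b : R) : 0 <= b ->
  f 0 = g 0 ->
  (forall x, 0 <= x <= b -> is_derive f x (df x)) ->
  (forall x, 0 <= x <= b -> is_derive g x (dg x)) ->
  (forall x, 0 <= x <= b -> df x <= dg x) ->
  f b <= g b.
Proof.
intros Hb H0 Hf Hg Hle.
assert (Hd : forall x, 0 <= x <= b ->
          is_derive (fun y => g y - f y) x (dg x - df x)).
{ intros x Hx; apply (is_derive_minus (V := R_NormedModule)); auto. }
destruct (MVT_gen (fun y => g y - f y) 0 b (fun x => dg x - df x))
  as [c [Hc He]].
- rewrite Rmin_left, Rmax_right by lra; intros x Hx; apply Hd; lra.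
- rewrite Rmin_left, Rmax_right by lra; intros x Hx.
  apply continuity_pt_filterlim.
  apply (ex_derive_continuous (V := R_NormedModule) (fun y => g y - f y)).
  eexists; apply Hd; lra.
- rewrite Rmin_left, Rmax_right in Hc by lra.
  specialize (Hle c Hc); simpl in He; nra.
Qed.

Lemma is_derive_log_ratio (x : R) : 0 <= x < 1 ->
  is_derive (fun y => ln ((1 + y) / (1 - y))) x (2 / (1 - x ^ 2)).
Proof.
intros Hx; auto_derive.
- split; [lra|split; [|trivial]]; apply Rdiv_lt_0_compat; lra.
- field; repeat split; nra.
Qed.

(** The derivative 2 / (1 - y^2) exceeds the partial sum of its geometric series. *)
Lemma log_ratio_lower_bound (y : R) : 0 <= y < 1 ->
  2 * (y + y ^ 3 / 3 + y ^ 5 / 5 + y ^ 7 / 7 + y ^ 9 / 9 + y ^ 11 / 11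
       + y ^ 13 / 13) <= ln ((1 + y) / (1 - y)).
Proof.
intros Hy.
apply (le_of_derive_le
  (fun y => 2 * (y + y ^ 3 / 3 + y ^ 5 / 5 + y ^ 7 / 7 + y ^ 9 / 9 + y ^ 11 / 11
       + y ^ 13 / 13)) (fun y => ln ((1 + y) / (1 - y)))
  (fun x => 2 * (1 + x ^ 2 + x ^ 4 + x ^ 6 + x ^ 8 + x ^ 10 + x ^ 12))
  (fun x => 2 / (1 - x ^ 2))); [lra| | | |].
- replace ((1 + 0) / (1 - 0)) with 1 by field; rewrite ln_1; field.
- intros x _; auto_derive; [trivial|field].
- intros x Hx; apply is_derive_log_ratio; lra.
- intros x Hx.
  assert (0 < 1 - x ^ 2) by nra.
  assert (0 <= x ^ 14) by (apply pow_le; lra).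
  apply Rmult_le_reg_r with (1 - x ^ 2); [lra|].
  replace (2 / (1 - x ^ 2) * (1 - x ^ 2)) with 2 by (field; lra).
  replace (_ * (1 - x ^ 2)) with (2 - 2 * x ^ 14) by ring; lra.
Qed.

(** Replacing every coefficient 1/(2k+1) with k >= 1 in the power series by 1/3
    gives the geometric series on the right. *)
Lemma log_ratio_upper_bound (y : R) : 0 <= y < 1 ->
  ln ((1 + y) / (1 - y)) <= 2 * y + 2 / 3 * y ^ 3 / (1 - y ^ 2).
Proof.
intros Hy.
apply (le_of_derive_le (fun y => ln ((1 + y) / (1 - y)))
  (fun y => 2 * y + 2 / 3 * y ^ 3 / (1 - y ^ 2))
  (fun x => 2 / (1 - x ^ 2))
  (fun x => 2 + 2 / 3 * (3 * x ^ 2 - x ^ 4) / (1 - x ^ 2) ^ 2)); [lra| | | |].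
- replace ((1 + 0) / (1 - 0)) with 1 by field; rewrite ln_1; field.
- intros x Hx; apply is_derive_log_ratio; lra.
- intros x Hx; assert (0 < 1 - x ^ 2) by nra.
  auto_derive; [simpl in *; lra|field; simpl in *; lra].
- intros x Hx.
  assert (0 < 1 - x ^ 2) by nra.
  assert (0 <= x ^ 4) by (apply pow_le; lra).
  assert (0 < / (1 - x ^ 2) ^ 2) by (apply Rinv_0_lt_compat, pow_lt; lra).
  apply Rminus_le.
  replace (_ - _) with (- (4 / 3 * x ^ 4 * / (1 - x ^ 2) ^ 2)) by (field; lra).
  nra.
Qed.

(** * Decrements of the logarithm of n! and of the Stirling series *)

(** The logarithm of n! / (sqrt n (n/e)^n), which tends to ln (2 pi) / 2. *)
Definition stirling_log (n : nat) : R :=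
  ln (INR (fact n)) - (INR n + / 2) * ln (INR n) + INR n.

Lemma stirling_log_step (n : nat) : (1 <= n)%nat ->
  let y := / (2 * INR n + 1) in
  stirling_log n - stirling_log (S n) = ln ((1 + y) / (1 - y)) / (2 * y) - 1.
Proof.
intros Hn y.
assert (HN : 0 < INR n) by (apply lt_0_INR; lia).
unfold stirling_log.
rewrite fact_simpl, mult_INR, ln_mult, S_INR
  by (try apply INR_fact_lt_0; apply lt_0_INR; lia).
replace ((1 + y) / (1 - y)) with ((INR n + 1) / INR n)
  by (unfold y; field; lra).
rewrite ln_div by lra.
unfold y; field; lra.
Qed.

(** The series ends with a negative term: this is what makes it a lower bound. *)
Definition stirling_series (x : R) : R :=
  1 / (12 * x) - 1 / (360 * x ^ 3) + 1 / (1260 * x ^ 5) - 1 / (1680 * x ^ 7)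
  + 1 / (1188 * x ^ 9) - 691 / (360360 * x ^ 11).

(** For odd k, (x+1)^k - x^k is invariant under x -> -1 - x, hence a polynomial in
    x (x + 1).  As (2x+1)^2 = 4 x (x+1) + 1, this makes the comparison with a
    series in (2x+1)^-2 one between rational functions of the single variable
    t = x (x + 1), of half the degree. *)
Lemma stirling_series_diff (x : R) : 0 < x ->
  let t := x * (x + 1) in
  stirling_series x - stirling_series (x + 1)
  = 1 / (12 * t) - (3 * t + 1) / (360 * t ^ 3)
    + (5 * t ^ 2 + 5 * t + 1) / (1260 * t ^ 5)
    - (7 * t ^ 3 + 14 * t ^ 2 + 7 * t + 1) / (1680 * t ^ 7)
    + (9 * t ^ 4 + 30 * t ^ 3 + 27 * t ^ 2 + 9 * t + 1) / (1188 * t ^ 9)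
    - 691 * (11 * t ^ 5 + 55 * t ^ 4 + 77 * t ^ 3 + 44 * t ^ 2 + 11 * t + 1)
      / (360360 * t ^ 11).
Proof.
intros Hx t.
assert (Hp : forall (k : nat) (a c p : R), a <> 0 ->
  c * ((x + 1) ^ k - x ^ k) = p ->
  c / (a * x ^ k) - c / (a * (x + 1) ^ k) = p / (a * t ^ k)).
{ intros k a c p Ha <-; unfold t; rewrite Rpow_mult_distr.
  field; repeat split; try apply pow_nonzero; lra. }
rewrite <- (pow_1 t) at 1.
unfold stirling_series.
rewrite <- (Hp 1%nat _ 1), <- (Hp 3%nat _ 1), <- (Hp 5%nat _ 1),
  <- (Hp 7%nat _ 1), <- (Hp 9%nat _ 1), <- (Hp 11%nat _ 691) by (lra || (unfold t; ring)).
rewrite !pow_1; ring.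
Qed.

(** Over the common denominator t^11 (4t+1)^6 the difference of the two sides has
    a numerator with positive coefficients only.  Its degree is 10 instead of 16
    because the Stirling series matches the expansion in w up to w^6. *)
Lemma artanh_series_ge_stirling_diff (t : R) : 0 < t ->
  let w := / (4 * t + 1) in
  1 / (12 * t) - (3 * t + 1) / (360 * t ^ 3)
    + (5 * t ^ 2 + 5 * t + 1) / (1260 * t ^ 5)
    - (7 * t ^ 3 + 14 * t ^ 2 + 7 * t + 1) / (1680 * t ^ 7)
    + (9 * t ^ 4 + 30 * t ^ 3 + 27 * t ^ 2 + 9 * t + 1) / (1188 * t ^ 9)
    - 691 * (11 * t ^ 5 + 55 * t ^ 4 + 77 * t ^ 3 + 44 * t ^ 2 + 11 * t + 1)
      / (360360 * t ^ 11)
  <= w / 3 + w ^ 2 / 5 + w ^ 3 / 7 + w ^ 4 / 9 + w ^ 5 / 11 + w ^ 6 / 13.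
Proof.
intros Ht w.
apply Rminus_le.
replace (_ - _) with
  (- ((691 / 360360 + 691 / 10296 * t + 567547 / 540540 * t ^ 2
       + 3481613 / 360360 * t ^ 3 + 2779781 / 48048 * t ^ 4
       + 508784327 / 2162160 * t ^ 5 + 1656889 / 2520 * t ^ 6
       + 22991897 / 18480 * t ^ 7 + 11511979 / 7560 * t ^ 8
       + 130289 / 120 * t ^ 9 + 20479 / 60 * t ^ 10)
      / (t ^ 11 * (4 * t + 1) ^ 6))).
- assert (Hk : forall k, 0 < t ^ k) by (intros k; apply pow_lt; lra).
  apply Rge_le, Ropp_0_le_ge_contravar, Rlt_le, Rdiv_lt_0_compat.
  + generalize (Hk 2%nat) (Hk 3%nat) (Hk 4%nat) (Hk 5%nat) (Hk 6%nat)
      (Hk 7%nat) (Hk 8%nat) (Hk 9%nat) (Hk 10%nat); lra.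
  + apply Rmult_lt_0_compat; apply pow_lt; lra.
- unfold w; field; lra.
Qed.

Lemma stirling_log_step_ge (n : nat) : (1 <= n)%nat ->
  stirling_series (INR n) - stirling_series (INR (S n))
  <= stirling_log n - stirling_log (S n).
Proof.
intros Hn.
assert (HN : 1 <= INR n) by (apply (le_INR 1); lia).
rewrite stirling_log_step by lia.
rewrite S_INR, stirling_series_diff by lra.
set (y := / (2 * INR n + 1)).
assert (Hy : 0 < y) by (apply Rinv_0_lt_compat; lra).
assert (Hy1 : y < 1) by (rewrite <- Rinv_1; apply Rinv_lt_contravar; lra).
assert (Hw : / (4 * (INR n * (INR n + 1)) + 1) = y ^ 2)
  by (unfold y; rewrite pow_inv; f_equal; ring).
etransitivity; [apply artanh_series_ge_stirling_diff; nra|].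
rewrite Hw.
apply Rmult_le_reg_r with (2 * y); [lra|].
replace ((ln ((1 + y) / (1 - y)) / (2 * y) - 1) * (2 * y))
  with (ln ((1 + y) / (1 - y)) - 2 * y) by (field; lra).
generalize (log_ratio_lower_bound y ltac:(lra)).
match goal with |- ?a <= _ -> ?b <= _ =>
  replace a with (b + 2 * y) by field end.
lra.
Qed.

(** The matching upper bound, with the first term of the series only; it serves to
    control stirling_log n - stirling_log (2n). *)
Lemma stirling_log_step_le (n : nat) : (1 <= n)%nat ->
  stirling_log n - stirling_log (S n) <= 1 / (12 * INR n) - 1 / (12 * INR (S n)).
Proof.
intros Hn.
assert (HN : 1 <= INR n) by (apply (le_INR 1); lia).
rewrite stirling_log_step by lia; rewrite S_INR.
set (y := / (2 * INR n + 1)).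
assert (Hy : 0 < y) by (apply Rinv_0_lt_compat; lra).
assert (Hy1 : y < 1) by (rewrite <- Rinv_1; apply Rinv_lt_contravar; lra).
apply Rmult_le_reg_r with (2 * y); [lra|].
replace ((ln ((1 + y) / (1 - y)) / (2 * y) - 1) * (2 * y))
  with (ln ((1 + y) / (1 - y)) - 2 * y) by (field; lra).
generalize (log_ratio_upper_bound y ltac:(lra)).
replace ((1 / (12 * INR n) - 1 / (12 * (INR n + 1))) * (2 * y))
  with (2 / 3 * y ^ 3 / (1 - y ^ 2)); [lra|].
unfold y; field; repeat split; nra.
Qed.

(** * The limit ln (2 pi) / 2 *)

Lemma antitone_from (u : nat -> R) (n m : nat) : (n <= m)%nat ->
  (forall k, (n <= k)%nat -> u (S k) <= u k) -> u m <= u n.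
Proof.
intros Hnm Hu; induction Hnm as [|m Hm IH]; [lra|].
specialize (Hu m Hm); lra.
Qed.

(** The left side is the limit of the right side, because every power of n
    and of 2 cancels when Wallis' inequality is written with [stirling_log]. *)
Lemma stirling_log_wallis (n : nat) : (1 <= n)%nat ->
  ln (2 * PI) / 2 <= 2 * stirling_log n - stirling_log (2 * n).
Proof.
intros Hn.
assert (HN : 0 < INR n) by (apply lt_0_INR; lia).
assert (HP := PI_RGT_0).
assert (Hf := INR_fact_lt_0 n); assert (Hg := INR_fact_lt_0 (2 * n)).
assert (H2n : 0 < 2 ^ n) by (apply pow_lt; lra).
assert (H1 : 0 < PI * INR n) by (apply Rmult_lt_0_compat; lra).
assert (H2 : 0 < INR (fact (2 * n)) ^ 2) by (apply pow_lt; lra).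
assert (H3 : 0 < 2 ^ n * INR (fact n)) by (apply Rmult_lt_0_compat; lra).
assert (HW : ln (PI * INR n * INR (fact (2 * n)) ^ 2)
             <= ln ((2 ^ n * INR (fact n)) ^ 4)).
{ apply ln_le; [|apply wallis_lower_bound; lia].
  apply Rmult_lt_0_compat; lra. }
rewrite !ln_mult, !ln_pow, ln_mult, ln_pow in HW by lra.
unfold stirling_log.
rewrite mult_INR; change (INR 2) with 2 in *; simpl (INR 4) in HW.
rewrite (ln_mult 2 (INR n)), (ln_mult 2 PI) by lra.
nra.
Qed.

(** Subtract from [stirling_log_wallis] the bound 1/(12n) - 1/(24n) for
    stirling_log n - stirling_log (2n), which holds as stirling_log n - 1/(12n) is
    nondecreasing. *)
Lemma stirling_log_ge (n : nat) : (1 <= n)%nat ->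
  ln (2 * PI) / 2 - 1 / (24 * INR n) <= stirling_log n.
Proof.
intros Hn.
assert (HN : 0 < INR n) by (apply lt_0_INR; lia).
assert (HW := stirling_log_wallis n Hn).
assert (Hs : stirling_log n - 1 / (12 * INR n)
             <= stirling_log (2 * n) - 1 / (12 * INR (2 * n))).
{ enough (1 / (12 * INR (2 * n)) - stirling_log (2 * n)
          <= 1 / (12 * INR n) - stirling_log n) by lra.
  apply (antitone_from (fun k => 1 / (12 * INR k) - stirling_log k)); [lia|].
  intros k Hk; generalize (stirling_log_step_le k ltac:(lia)); lra. }
rewrite mult_INR in Hs; simpl (INR 2) in Hs.
replace (1 / (12 * ((1 + 1) * INR n))) with (1 / (24 * INR n)) in Hs
  by (field; lra).
replace (1 / (12 * INR n)) with (2 * (1 / (24 * INR n))) in Hs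
  by (field; lra).
lra.
Qed.

Lemma stirling_series_le (x : R) : 1 <= x -> stirling_series x <= 1 / x.
Proof.
intros Hx.
assert (Hk : forall k, 0 < x ^ k) by (intros k; apply pow_lt; lra).
apply Rminus_le; unfold stirling_series.
replace (_ - _) with
  (- ((11 / 12 * x ^ 10 + x ^ 8 / 360 - x ^ 6 / 1260 + x ^ 4 / 1680
       - x ^ 2 / 1188 + 691 / 360360) / x ^ 11)) by (field; lra).
apply Rge_le, Ropp_0_le_ge_contravar, Rlt_le, Rdiv_lt_0_compat; [|apply Hk].
assert (H2 : x ^ 2 <= x ^ 10) by (apply Rle_pow; [lra|lia]).
assert (H6 : x ^ 6 <= x ^ 10) by (apply Rle_pow; [lra|lia]).
generalize (Hk 8%nat) (Hk 4%nat) (Hk 10%nat); lra.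
Qed.

(** If the inequality failed by eps, monotonicity of stirling_log - stirling_series
    would propagate the gap eps to every m >= n, against [stirling_log_ge] once
    m > 2/eps. *)
Lemma stirling_series_le_stirling_log (n : nat) : (1 <= n)%nat ->
  ln (2 * PI) / 2 + stirling_series (INR n) <= stirling_log n.
Proof.
intros Hn.
apply Rnot_lt_le; intros Hlt.
set (eps := ln (2 * PI) / 2 + stirling_series (INR n) - stirling_log n) in *.
assert (Heps : 0 < eps) by (unfold eps; lra).
destruct (INR_unbounded (2 / eps)) as [p Hp].
set (m := (n + p)%nat).
assert (Hm : 2 / eps < INR m)
  by (unfold m; rewrite plus_INR; generalize (pos_INR n); lra).
assert (Hm1 : 1 <= INR m) by (apply (le_INR 1); unfold m; lia).
assert (Hanti := antitone_from (fun k => stirling_log k - stirling_series (INR k))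
  n m ltac:(unfold m; lia)
  ltac:(intros k Hk; generalize (stirling_log_step_ge k ltac:(lia)); lra)).
assert (Hge := stirling_log_ge m ltac:(unfold m; lia)).
assert (Hser := stirling_series_le (INR m) Hm1).
assert (Hinv : 2 * (1 / INR m) < eps).
{ apply Rmult_lt_reg_r with (INR m); [lra|].
  replace (2 * (1 / INR m) * INR m) with 2 by (field; lra).
  replace 2 with (eps * (2 / eps)) by (field; lra).
  apply Rmult_lt_compat_l; lra. }
replace (1 / (24 * INR m)) with (1 / INR m / 24) in Hge by (field; lra).
assert (0 < 1 / INR m) by (apply Rdiv_lt_0_compat; lra).
unfold eps in Hinv; lra.
Qed.

(** * From the Stirling series to the rational bound *)

(** Over a common denominator the cubic terms in w = x^2 cancel, and the quadratic
    that remains has the tiny leading coefficient 1680/1188 - 2375/1680 > 0; its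
    positive root lies between 52^2 and 53^2. *)
Lemma rational_bound_le_stirling_series (x : R) : 53 <= x ->
  1 / (12 * x) - 1 / (360 * x ^ 3) + 1 / (1260 * x ^ 5)
    - 1 / (1680 * x ^ 7 + 2375 * x ^ 5) <= stirling_series x.
Proof.
intros Hx.
set (w := x ^ 2).
assert (Hw : 53 ^ 2 <= w) by (apply pow_incr; lra).
assert (Hk : forall k, 0 < x ^ k) by (intros k; apply pow_lt; lra).
apply Rminus_le; unfold stirling_series.
replace (_ - _) with
  (- (((1680 / 1188 - 2375 / 1680) * w ^ 2
       + (2375 / 1188 - 691 * 1680 / 360360) * w - 691 * 2375 / 360360)
      / (x ^ 11 * (1680 * w + 2375))))
  by (unfold w; field; generalize (Hk 2%nat) (Hk 5%nat) (Hk 7%nat);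
      repeat split; simpl in *; lra).
apply Rge_le, Ropp_0_le_ge_contravar, Rlt_le, Rdiv_lt_0_compat.
- nra.
- apply Rmult_lt_0_compat; [apply Hk|lra].
Qed.

Lemma fact_eq_stirling (n : nat) : (1 <= n)%nat ->
  INR (fact n) = sqrt (2 * PI * INR n) * (INR n / exp 1) ^ n
                 * exp (stirling_log n - ln (2 * PI) / 2).
Proof.
intros Hn.
assert (HN : 0 < INR n) by (apply lt_0_INR; lia).
assert (HP := PI_RGT_0).
assert (He := exp_pos 1).
assert (Hq : 0 < INR n / exp 1) by (apply Rdiv_lt_0_compat; lra).
assert (Hs : 0 < sqrt (2 * PI * INR n)) by (apply sqrt_lt_R0; nra).
assert (Hp : 0 < (INR n / exp 1) ^ n) by (apply pow_lt; lra).
apply ln_inv.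
- apply INR_fact_lt_0.
- repeat apply Rmult_lt_0_compat; auto using exp_pos.
- assert (Hl : 2 * ln (sqrt (2 * PI * INR n)) = ln (2 * PI) + ln (INR n)).
  { rewrite <- ln_mult by nra.
    rewrite <- (sqrt_sqrt (2 * PI * INR n)) at 2 by nra.
    rewrite ln_mult by lra; ring. }
  assert (Hsp : 0 < sqrt (2 * PI * INR n) * (INR n / exp 1) ^ n)
    by (apply Rmult_lt_0_compat; lra).
  rewrite !ln_mult, ln_exp, ln_pow, ln_div, ln_exp by (assumption || apply exp_pos).
  unfold stirling_log; lra.
Qed.

Theorem mainTheorem6 : forall n : nat, (53 <= n)%nat ->
  INR (fact n) >=
    sqrt (2 * PI * INR n) * (INR n / exp 1) ^ n
    * exp (1 / (12 * INR n) - 1 / (360 * INR n ^ 3) + 1 / (1260 * INR n ^ 5)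
           - 1 / (1680 * INR n ^ 7 + 2375 * INR n ^ 5)).
Proof.
intros n Hn.
assert (HN : 53 <= INR n) by (apply (le_INR 53) in Hn; simpl in Hn; lra).
rewrite (fact_eq_stirling n) by lia.
apply Rle_ge, Rmult_le_compat_l.
- apply Rmult_le_pos; [apply sqrt_pos|].
  apply pow_le, Rlt_le, Rdiv_lt_0_compat; [lra|apply exp_pos].
- apply Rnot_lt_le; intros H; apply exp_lt_inv in H; revert H; apply Rle_not_lt.
  generalize (rational_bound_le_stirling_series _ HN)
    (stirling_series_le_stirling_log n ltac:(lia)); lra.
Qed.
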